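(* Suppose the real values $\lambda_1\ge\cdots\ge\lambda_M$ and $N\in\mathbb{N}$ satisfy $\sum_{j=1}^M\lambda_j=N$ as well as the following conditions. (i) $\lambda_M\ge2$. (ii) If $j_0$ is the first integer in $\{1,\dots,M\}$ for which $\lambda_{j_0}$ is not an integer, then $\lfloor\lambda_{j_0}\rfloor\le N-3$. Then the eigenvalues (counted with multiplicity) of the frame operator of the frame $\{w_k\}_{k=1}^N$ for $\mathbb{R}^M$ constructed by the algorithm FFCRE are $\{\lambda_j\}_{j=1}^M$.
   Context: The frame operator of vectors $\{w_k\}_{k=1}^N$ in $\mathbb{R}^M$ is $f\mapsto\sum_{k=1}^N\langle f,w_k\rangle w_k$; the vectors form a frame for $\mathbb{R}^M$ if this operator is positive definite. Algorithm FFCRE. Let $e_1,\dots,e_M$ be the standard unit vectors of $\mathbb{R}^M$. Maintain current values $c_1,\dots,c_M$, initially $c_j=\lambda_j$, and a counter $k$, initially $k=1$. For $j=1,\dots,M$ in this order, repeat the following until $c_j=0$: (a) if $0<c_j<1$, put $w_k:=\sqrt{c_j/2}\,e_j+\sqrt{1-c_j/2}\,e_{j+1}$ and $w_{k+1}:=\sqrt{c_j/2}\,e_j-\sqrt{1-c_j/2}\,e_{j+1}$, then replace $k$ by $k+2$, $c_{j+1}$ by $c_{j+1}-(2-c_j)$, and $c_j$ by $0$; (b) otherwise (i.e. $c_j\ge1$), put $w_k:=e_j$, then replace $k$ by $k+1$ and $c_j$ by $c_j-1$. Under the stated hypotheses, the algorithm runs without using $e_{M+1}$ or producing negative values $c_j$,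 and outputs exactly $N$ vectors. *)

(* Defs.v *)
From mathcomp Require Import all_boot all_order all_algebra reals.

Set Implicit Arguments.
Unset Strict Implicit.
Unset Printing Implicit Defensive.

Import Order.TTheory GRing.Theory Num.Theory.
Local Open Scope ring_scope.

Definition dotv (R : realType) (n : nat) (u v : 'rV[R]_n) : R :=
  \sum_(i < n) u 0 i * v 0 i.

Definition frame_op (R : realType) (n : nat) (ws : seq 'rV[R]_n)
    (f : 'rV[R]_n) : 'rV[R]_n :=
  \sum_(w <- ws) dotv f w *: w.

(* The frame operator is symmetric for every [ws], so positivity of its
   quadratic form is the only condition needed for positive definiteness. *)
Definition is_frame (R : realType) (n : nat) (ws : seq 'rV[R]_n) : Prop :=
  forall f : 'rV[R]_n, f != 0 -> 0 < dotv (frame_op ws f) f.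

(* The matrix of the frame operator, acting on row vectors. *)
Definition frame_mx (R : realType) (n : nat) (ws : seq 'rV[R]_n) : 'M[R]_n :=
  lin1_mx (frame_op ws).

Definition unit_vec (R : realType) (n : nat) (j : 'I_n) : 'rV[R]_n :=
  delta_mx 0 j.
Arguments unit_vec R {n} j.

(* [FFCRE_from c j ws]: with current values [c], the outer loop standing at
   index [j] (0-based), the algorithm runs to completion and the vectors it
   still outputs are [ws], in this order; the counter [k] is the position in
   the output list.  The rules are mutually exclusive.  There is no rule for a
   pair step at the last index (which would use a unit vector outside the
   space) nor for a negative value [c j], so such a run does not complete. *)
Inductive FFCRE_from (R : realType) (n : nat) :
    ('I_n -> R) -> nat -> seq 'rV[R]_n -> Prop :=
| FFCRE_done (c : 'I_n -> R) : FFCRE_from c n [::]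
| FFCRE_next (c : 'I_n -> R) (j : 'I_n) (ws : seq 'rV[R]_n) :
    c j = 0 -> FFCRE_from c j.+1 ws -> FFCRE_from c j ws
| FFCRE_pair (c : 'I_n -> R) (j j' : 'I_n) (ws : seq 'rV[R]_n) :
    j' = j.+1 :> nat -> 0 < c j < 1 ->
    FFCRE_from [eta c with j |-> 0, j' |-> c j' - (2 - c j)] j ws ->
    FFCRE_from c j
      [:: Num.sqrt (c j / 2) *: unit_vec R j
            + Num.sqrt (1 - c j / 2) *: unit_vec R j',
          Num.sqrt (c j / 2) *: unit_vec R j
            - Num.sqrt (1 - c j / 2) *: unit_vec R j'
        & ws]
| FFCRE_single (c : 'I_n -> R) (j : 'I_n) (ws : seq 'rV[R]_n) :
    1 <= c j ->
    FFCRE_from [eta c with j |-> c j - 1] j ws ->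
    FFCRE_from c j (unit_vec R j :: ws).

Definition FFCRE (R : realType) (n : nat) (lam : 'I_n -> R)
    (ws : seq 'rV[R]_n) : Prop :=
  FFCRE_from lam 0 ws.

(* Main.v *)
(* Each step of the algorithm contributes a diagonal matrix to the frame
   operator: the cross terms of the two vectors of a pair step cancel, leaving
   [c_j] at [e_j] and [2 - c_j] at [e_{j+1}].  Hence what a run from index [j]
   outputs has the frame operator [diag (0, .., 0, c_j, .., c_n)], and as each
   vector has unit norm, its length is the trace.  A run can always go on: a
   pair step removes less than [2] from the next value, and at the last index
   the remaining value, being integral, is never strictly between [0] and [1]. *)
Require Import Defs.
From mathcomp Require Import all_boot all_order all_algebra reals.
From mathcomp Require Import ring lra.

Set Implicit Arguments.
Unset Strict Implicit.
Unset Printing Implicit Defensive.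

Import Order.TTheory GRing.Theory Num.Theory.
Local Open Scope ring_scope.

Section Run.
Variables (R : realType) (n : nat).
Implicit Types (c : 'I_n -> R) (ws : seq 'rV[R]_n) (f : 'rV[R]_n).

Lemma dotvDr f u v : dotv f (u + v) = dotv f u + dotv f v.
Proof.
by rewrite /dotv -big_split; apply: eq_bigr => i _; rewrite mxE mulrDr.
Qed.

Lemma dotvZr f a u : dotv f (a *: u) = a * dotv f u.
Proof. by rewrite /dotv mulr_sumr; apply: eq_bigr => i _; rewrite mxE mulrCA. Qed.

Lemma dotvNr f u : dotv f (- u) = - dotv f u.
Proof. by rewrite -scaleN1r dotvZr mulN1r. Qed.

Lemma dotv_unit f (j : 'I_n) : dotv f (unit_vec R j) = f 0 j.
Proof.
rewrite /dotv (bigD1 j) //= big1 => [|i /negPf ij]; rewrite mxE !eqxx.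
  by rewrite mulr1 addr0.
by rewrite ij mulr0.
Qed.

Lemma FFCRE_frame_op c j ws f i : FFCRE_from c j ws ->
  frame_op ws f 0 i = (j <= i)%:R * (c i * f 0 i).
Proof.
elim=> {c j ws} [c|c j ws cj0 _ IH|c j j' ws jj' /andP[c0 c1] _ IH
                 |c j ws c1 _ IH].
- by rewrite /frame_op big_nil mxE leqNgt ltn_ord mul0r.
(* Moving on from [j] changes the indicator only at [i = j], where the coefficient [c j] vanishes
   anyway. *)
- rewrite IH; case: (eqVneq j i) => [<-|ji]; first by rewrite cj0 !(mul0r, mulr0).
  by rewrite (leq_eqVlt j) (inj_eq val_inj) (negPf ji).
- rewrite /frame_op !big_cons -/(frame_op _ _) mxE [(_ + frame_op _ _) 0 i]mxE IH.
  set a := Num.sqrt _; set b := Num.sqrt _.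
  have a2 : a ^+ 2 = c j / 2 by rewrite sqr_sqrtr //; lra.
  have b2 : b ^+ 2 = 1 - c j / 2 by rewrite sqr_sqrtr //; lra.
  have nj : (j' == j) = false by rewrite -val_eqE /= jj' gtn_eqF.
  rewrite !(dotvDr, dotvNr, dotvZr, dotv_unit) /unit_vec !mxE !eqxx /=.
  case: (eqVneq i j) => [->|_]; last case: (eqVneq i j') => [->|_].
  (* Expressing [c j] through [a] or [b] removes the square roots: [2 * a ^+ 2] is the whole of
     [c j], and [2 * b ^+ 2] restores the [2 - c j] taken from [c j']. *)
  + rewrite leqnn [j == j']eq_sym nj /=.
    by rewrite [c j](_ : _ = 2 * a ^+ 2); [ring | rewrite a2; lra].
  + rewrite jj' leqnSn /= [c j](_ : _ = 2 - 2 * b ^+ 2); [ring | rewrite b2; lra].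
  + by rewrite !(mulr0, addr0, subr0, add0r).
- rewrite /frame_op big_cons -/(frame_op _ _) mxE IH dotv_unit !mxE eqxx /=.
  by case: (eqVneq i j) => [->|_]; rewrite ?leqnn /=; ring.
Qed.

(** The trace of the operator that a run from [j] produces. The index is a natural number so that
    [j = n] gives the empty sum at the end of a run. *)
Definition tail_sum c (j : nat) : R := \sum_(i < n | (j <= i)%N) c i.

Lemma tail_sum_recl c (j : 'I_n) : tail_sum c j = c j + tail_sum c j.+1.
Proof.
rewrite /tail_sum (bigD1 j) //=; congr (_ + _); apply: eq_bigl => i.
by rewrite ltn_neqAle (inj_eq val_inj) eq_sym andbC.
Qed.

Lemma tail_sum_size c : tail_sum c n = 0.
Proof. by rewrite /tail_sum big_pred0 // => i; rewrite leqNgt ltn_ord. Qed.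

Lemma eq_tail_sum c c' j : (forall i : 'I_n, (j <= i)%N -> c i = c' i) ->
  tail_sum c j = tail_sum c' j.
Proof. exact: eq_bigr. Qed.

Lemma tail_sum_single c (j : 'I_n) :
  tail_sum [eta c with j |-> c j - 1] j = tail_sum c j - 1.
Proof.
rewrite !(tail_sum_recl _ j) /= eqxx (@eq_tail_sum _ c) 1?addrAC // => i ji /=.
by rewrite -val_eqE /= gtn_eqF.
Qed.

(** The losses [c j] at [j] and [2 - c j] at [j'] add up to the number of vectors output. *)
Lemma tail_sum_pair c (j j' : 'I_n) : j' = j.+1 :> nat ->
  tail_sum [eta c with j |-> 0, j' |-> c j' - (2 - c j)] j = tail_sum c j - 2.
Proof.
move=> jj'; rewrite !(tail_sum_recl _ j) -jj' !(tail_sum_recl _ j') /= !eqxx.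
have -> : (j' == j) = false by rewrite -val_eqE /= jj' gtn_eqF.
rewrite (@eq_tail_sum _ c) => [|i ji /=]; first ring.
by rewrite -!val_eqE /= !gtn_eqF // -ltnS -jj' ltnW.
Qed.

Lemma FFCRE_size c j ws : FFCRE_from c j ws -> (size ws)%:R = tail_sum c j.
Proof.
elim=> {c j ws} [c|c j ws cj0 _ IH|c j j' ws jj' _ _ IH|c j ws _ _ IH] /=.
- by rewrite tail_sum_size.
- by rewrite tail_sum_recl cj0 add0r.
- by rewrite -addn2 natrD IH tail_sum_pair // subrK.
- by rewrite -natr1 IH tail_sum_single subrK.
Qed.

(** The hypotheses are an invariant of the run: only the current value may have fallen below 2, and
    the remaining sum stays integral since each step subtracts 1 or 2. *)
Lemma FFCRE_exists c j :
    (j <= n)%N -> (forall i : 'I_n, i = j :> nat -> 0 <= c i) ->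
    (forall i : 'I_n, (j < i)%N -> 2 <= c i) -> tail_sum c j \is a Num.int ->
  exists ws, FFCRE_from c j ws.
Proof.
move=> jn; have [d] := ubnP (n - j)%N.
elim: d c j jn => // d IHd c j jn ltd.
move: (jn); rewrite leq_eqVlt => /predU1P[-> *|jltn].
  by exists [::]; apply: FFCRE_done.
pose oj := Ordinal jltn; rewrite -[j]/(val oj) => /(_ oj erefl).
(* Inner induction on a natural strict upper bound [k] of the current value, which a single step
   lowers by 1; [k = 0] contradicts [c0]. *)
have := Num.Theory.truncnS_gt (c oj).
move: (Num.truncn _).+1 => k; elim: k c => [|k IHk] c ck c0 c2 cint.
  by move: (le_lt_trans c0 ck); rewrite ltxx.
(* Leaving index [j] once its value is zero, which serves both [c oj = 0] and the state after a pair
   step. The value at [j.+1] is only required to be nonnegative, as a pair step may bring it below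
   2. *)
have next c' : (forall i : 'I_n, i = j.+1 :> nat -> 0 <= c' i) ->
    (forall i : 'I_n, (j < i)%N -> i != j.+1 :> nat -> 2 <= c' i) ->
    tail_sum c' oj \is a Num.int -> c' oj = 0 -> exists ws, FFCRE_from c' oj ws.
  move=> c'0 c'2 c'int c'j0.
  have ltd' : (n - j.+1 < d)%N.
    by move: ltd; rewrite ltnS; apply: leq_trans; rewrite ltn_sub2l.
  have [i ji||ws run] := IHd c' j.+1 jltn ltd' c'0.
  - by apply: c'2; [apply: ltnW | rewrite gtn_eqF].
  - by move: c'int; rewrite tail_sum_recl c'j0 add0r.
  by exists ws; apply: FFCRE_next.
have [c1|c1] := lerP 1 (c oj).
  have [||i ji||ws run] := IHk [eta c with oj |-> c oj - 1].
  - by rewrite /= eqxx ltrBlDr natr1.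
  - by rewrite /= eqxx subr_ge0.
  - by rewrite /= -val_eqE /= gtn_eqF // c2.
  - by rewrite tail_sum_single rpredB ?rpred1.
  by exists (unit_vec R oj :: ws); apply: FFCRE_single.
move: c0; rewrite le_eqVlt => /predU1P[cj0|c0].
  apply: next => // [i ij|i ji _]; last exact: c2.
  by apply: le_trans (c2 i _); rewrite /= ?ij.
have [jlast|jnlast] := eqVneq j.+1 n.
  move: cint; rewrite tail_sum_recl jlast tail_sum_size addr0.
  move=> /intrP[z cz]; move: c0 c1; rewrite cz ltr0z (ltrz1 R).
  by case: z {cz} => [[|[]]|].
have j1n : (j.+1 < n)%N by rewrite ltn_neqAle jnlast.
pose oj' := Ordinal j1n.
have nj : (oj' == oj) = false by rewrite -val_eqE /= gtn_eqF.
have [i ij|i ji ij|||ws run] := next [eta c with oj |-> 0, oj' |-> c oj' - (2 - c oj)].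
- have -> : i = oj' by apply: val_inj.
  by rewrite /= nj eqxx; have := c2 oj' (leqnn _); lra.
- by rewrite /= -!val_eqE /= (negPf ij) gtn_eqF //; apply: c2.
- by rewrite tail_sum_pair // rpredB ?rpred_nat.
- by rewrite /= eqxx.
by eexists; apply: (@FFCRE_pair _ _ c oj oj' ws) => //; rewrite c0.
Qed.

End Run.

(* The dimension is m.+1, so that the last value is [lam ord_max]. *)
Theorem corollary4p9 (R : realType) (m N : nat) (lam : 'I_m.+1 -> R)
  (lam_noninc : forall i j : 'I_m.+1, (i <= j)%N -> lam j <= lam i)
  (lam_sum : \sum_(j < m.+1) lam j = N%:R)
  (lam_last : 2 <= lam ord_max)
  (lam_floor : forall j0 : 'I_m.+1,
     lam j0 \isn't a Num.int ->
     (forall j : 'I_m.+1, (j < j0)%N -> lam j \is a Num.int) ->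
     (Num.floor (lam j0) <= N%:Z - 3)%R) :
  (exists ws : seq 'rV[R]_m.+1, FFCRE lam ws) /\
  (forall ws : seq 'rV[R]_m.+1, FFCRE lam ws ->
     [/\ size ws = N,
         is_frame ws
       & char_poly (frame_mx ws) = \prod_(j < m.+1) ('X - (lam j)%:P)]).
Proof.
have lam2 j : 2 <= lam j.
  exact: le_trans lam_last (lam_noninc j ord_max (leq_ord j)).
have lamS : tail_sum lam 0 = N%:R by rewrite -lam_sum.
split=> [|ws run].
  apply: FFCRE_exists => // [i _|]; first exact: le_trans (lam2 i).
  by rewrite lamS; apply: rpred_nat.
have opE f i : frame_op ws f 0 i = lam i * f 0 i.
  by rewrite (FFCRE_frame_op f i run) mul1r.
split.
- by apply/eqP; rewrite -(eqr_nat R) (FFCRE_size run) lamS.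
(* The quadratic form is the sum of the [lam k * f 0 k ^+ 2]; a nonzero coordinate [i] makes its
   term positive. *)
- move=> f /rV0Pn[i fi]; rewrite /dotv (bigD1 i) //= opE ltr_wpDr //.
    apply: sumr_ge0 => k _; rewrite opE -mulrA mulr_ge0 -?expr2 ?sqr_ge0 //.
    exact: le_trans (lam2 k).
  rewrite -mulrA mulr_gt0 -?expr2 ?exprn_even_gt0 //.
  exact: lt_le_trans (lam2 i).
- have -> : frame_mx ws = diag_mx (\row_i lam i).
    apply/matrixP => i j; rewrite !mxE opE !mxE eqxx /= eq_sym mulr_natr.
    by case: eqVneq => // ->.
  rewrite char_poly_trig ?diag_mx_is_trig //.
  by apply: eq_bigr => j _; rewrite !mxE eqxx.
Qed.
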